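(* Let $\mathcal L:\sum_{i=1}^kc_ix_i=0$ be a homogeneous linear equation with $k\ge3$ and $c_1,\dots,c_k\in\mathbb Z\setminus\{0\}$, and assume there is $I\subseteq[k]$ with $|I|\ge3$ and $\sum_{i\in I}c_i=0$. Then for every $\varepsilon>0$ there exists $C=C(\varepsilon,\mathcal L)$ such that for every prime $p$ and every $\mathcal L$-solution-free set $A\subseteq\mathbb F_p$ with $|A|\ge\varepsilon p$, we have $\chi(\mathsf{Cay}(\mathbb F_p,A))\le C$.
   Context: A set $A\subseteq\mathbb F_p$ is $\mathcal L$-solution-free if there is no $(x_1,\dots,x_k)\in A^k$ with pairwise distinct entries and $\sum_ic_ix_i=0$ in $\mathbb F_p$. $\mathsf{Cay}(\mathbb F_p,A)$ is the Cayley digraph with arc $u\to v$ iff $v-u\in A$; $\chi$ is the chromatic number of its underlying undirected graph. *)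

(* Defs.v *)
From HB Require Import structures.
From mathcomp Require Import all_boot all_order all_algebra.
From mathcomp Require Import reals.
Set Implicit Arguments. Unset Strict Implicit. Unset Printing Implicit Defensive.
Import Order.TTheory GRing.Theory Num.Theory.
Local Open Scope ring_scope.

Definition solution_free (k p : nat) (c : 'I_k -> int) (A : {set 'F_p}) : Prop :=
  ~ exists x : 'I_k -> 'F_p,
      [/\ injective x, (forall i, x i \in A) & \sum_(i < k) (c i)%:~R * x i = 0].

(* Underlying undirected (simple) graph of the Cayley digraph Cay(F_p, A):
   u ~ v iff u <> v and (v - u \in A or u - v \in A). *)
Definition cay_adj (p : nat) (A : {set 'F_p}) (u v : 'F_p) : bool :=
  (u != v) && ((v - u \in A) || (u - v \in A)).

Definition cay_colorable (p : nat) (A : {set 'F_p}) (C : nat) : Prop :=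
  exists f : 'F_p -> 'I_C, forall u v, cay_adj A u v -> f u != f v.

(* Main.v *)
Require Import Defs.
From HB Require Import structures.
From mathcomp Require Import all_boot all_order all_algebra.
From mathcomp Require Import reals.
From mathcomp Require Import ring lra zify.
Import Order.TTheory GRing.Theory Num.Theory.
Local Open Scope ring_scope.
Set Implicit Arguments. Unset Strict Implicit. Unset Printing Implicit Defensive.

(** Let f be the indicator of A. Call t an almost period of g when g(. + t) is close
    to g in mean square. If g is an average of translates of a bounded function over a
    dense set, then by random sampling F_p has a colouring with boundedly many colours
    such that the difference of two points of the same colour is an almost period of g.

    Because |I| >= 3, the density of solutions of sum_(i in I) c_i x_i = w in A moves
    little when w moves by (a dilate of) an almost period of the autocorrelation of f.
    At w = 0 this density is at least some delta > 0 (Roth's theorem with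
    multiplicity, as sum_(i in I) c_i = 0): smoothing f over finer and finer sets of
    almost periods increases an energy bounded by 1, so at some stage two successive
    smoothings nearly agree; the finer one has about as many solutions as f, and the
    coarser one is almost invariant under many translations, which yields solutions
    near the diagonal.

    Hence if A contained k distinct common almost periods, they could be used for the
    unknowns outside I, and the equation in the remaining ones would still have many
    solutions, some with distinct entries. So A contains fewer than k of them, and
    inside each colour class the Cayley graph has degree less than 2k. *)

(** * Averages over finite sets *)

Section Average.
Variables (R : realType).

(** On the empty set the value is 0, since dividing by 0 gives 0; this is why upper bounds such as
    [av_le] ask for [0 <= a]. *)
Definition av (T : finType) (S : {set T}) (h : T -> R) : R :=
  (\sum_(s in S) h s) / #|S|%:R.

Variables (T : finType).
Implicit Types (S : {set T}) (h : T -> R).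

Lemma eq_av S h1 h2 : {in S, h1 =1 h2} -> av S h1 = av S h2.
Proof. by move=> e; rewrite /av (eq_bigr h2). Qed.

Lemma av_cst S (a : R) : S != set0 -> av S (fun=> a) = a.
Proof.
move=> S0; rewrite /av sumr_const -[a *+ _]mulr_natr mulfK //.
by rewrite pnatr_eq0 cards_eq0.
Qed.

Lemma avD S h1 h2 : av S (fun x => h1 x + h2 x) = av S h1 + av S h2.
Proof. by rewrite /av big_split /= mulrDl. Qed.

Lemma avN S h : av S (fun x => - h x) = - av S h.
Proof. by rewrite /av sumrN mulNr. Qed.

Lemma avB S h1 h2 : av S (fun x => h1 x - h2 x) = av S h1 - av S h2.
Proof. by rewrite avD avN. Qed.

Lemma avZl S (a : R) h : av S (fun x => a * h x) = a * av S h.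
Proof. by rewrite /av -mulr_sumr mulrA. Qed.

Lemma avZr S (a : R) h : av S (fun x => h x * a) = av S h * a.
Proof. by rewrite mulrC -avZl; apply: eq_av => x _; rewrite mulrC. Qed.

Lemma ler_av S h1 h2 : (forall x, x \in S -> h1 x <= h2 x) -> av S h1 <= av S h2.
Proof.
by move=> le12; apply: ler_wpM2r; rewrite ?invr_ge0 ?ler0n // ler_sum.
Qed.

Lemma av_ge0 S h : (forall x, x \in S -> 0 <= h x) -> 0 <= av S h.
Proof.
by move=> h0; rewrite /av mulr_ge0 ?invr_ge0 ?ler0n // sumr_ge0.
Qed.

Lemma ler_norm_av S h : `|av S h| <= av S (fun x => `|h x|).
Proof.
rewrite /av normrM normfV normr_nat; apply: ler_wpM2r.
  by rewrite invr_ge0 ler0n.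
exact: ler_norm_sum.
Qed.

Lemma av_le S h (a : R) : 0 <= a -> (forall x, x \in S -> h x <= a) -> av S h <= a.
Proof.
move=> a0 ha; have [->|S0] := eqVneq S set0.
  by rewrite /av big_set0 mul0r.
by rewrite -(av_cst a S0); apply: ler_av.
Qed.

Lemma norm_av_le S h (a : R) :
  0 <= a -> (forall x, x \in S -> `|h x| <= a) -> `|av S h| <= a.
Proof. by move=> a0 ha; apply: le_trans (ler_norm_av _ _) (av_le a0 ha). Qed.

(** For nonempty [S], the difference of the two sides is the variance of [h] on [S]. *)
Lemma av_sqr_le S h : av S h ^+ 2 <= av S (fun x => h x ^+ 2).
Proof.
have [->|S0] := eqVneq S set0; first by rewrite /av !big_set0 !mul0r expr0n.
rewrite -subr_ge0.
suff -> : av S (fun x => h x ^+ 2) - av S h ^+ 2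
          = av S (fun x => (h x - av S h) ^+ 2).
  by apply: av_ge0 => x _; exact: sqr_ge0.
set a := av S h.
transitivity (av S (fun x => h x ^+ 2 + - (2 * a) * h x + a ^+ 2)).
  by rewrite !avD avZl (av_cst _ S0) -/a; ring.
by apply: eq_av => x _; ring.
Qed.

Lemma av_reindex (T' : finType) (S : {set T}) (S' : {set T'}) (f : T' -> T) h :
  {in S' &, injective f} -> f @: S' = S -> av S' (fun x => h (f x)) = av S h.
Proof.
by move=> fi <-; rewrite /av (card_in_imset fi) big_imset.
Qed.

(** [B] may be negative: in the application it is a main term minus errors. *)
Lemma av_restrict S h (B t : R) : (0 < #|T|)%N -> (forall x, 0 <= h x) ->
  (forall x, x \in S -> B <= h x) -> 0 <= t -> t * #|T|%:R <= #|S|%:R ->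
  t * B <= av [set: T] h.
Proof.
move=> T0 h0 hB t0 hS.
have [B0|B0] := leP 0 B; last first.
  by apply: (@le_trans _ _ 0); [rewrite mulr_ge0_le0 // ltW | exact: av_ge0].
rewrite /av cardsT ler_pdivlMr ?ltr0n // mulrAC.
apply: le_trans (ler_wpM2r B0 hS) _.
rewrite mulr_natl -sumr_const; apply: (@le_trans _ _ (\sum_(x in S) h x)).
  exact: ler_sum.
rewrite [leRHS](bigID (mem S)) /= -[leLHS]addr0 lerD ?sumr_ge0 //.
by rewrite le_eqVlt; apply/orP; left; apply/eqP; apply: eq_bigl => x; rewrite inE.
Qed.

End Average.

Lemma exchange_av (R : realType) (T1 T2 : finType) (S1 : {set T1}) (S2 : {set T2})
    (h : T1 -> T2 -> R) :
  av S1 (fun x => av S2 (h x)) = av S2 (fun y => av S1 (h^~ y)).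
Proof.
rewrite /av -!mulr_suml exchange_big /= -!mulrA; congr (_ * _); exact: mulrC.
Qed.

Lemma av_setX (R : realType) (T1 T2 : finType) (S1 : {set T1}) (S2 : {set T2})
    (h : T1 * T2 -> R) :
  av (setX S1 S2) h = av S1 (fun x => av S2 (fun y => h (x, y))).
Proof.
rewrite /av cardsX natrM invfM -mulr_suml mulrA mulrAC; congr (_ / _ / _).
rewrite pair_big_dep /=.
by apply: eq_big => [[x y]|[x y] _] //; rewrite in_setX.
Qed.

Lemma eq_ler (R : realType) (x y : R) : x = y -> x <= y.
Proof. by move->. Qed.

(** * Mean squares, autocorrelation and translations over a finite field *)

Section Field.
Variables (R : realType) (F : finFieldType).
Local Notation E := (av [set: F]).
Implicit Types (f g h u : F -> R) (c w t d : F).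

Lemma setF_neq0 : [set: F] != set0.
Proof. by apply/set0Pn; exists 0; rewrite inE. Qed.

Lemma E_cst (a : R) : E (fun=> a) = a.
Proof. exact: av_cst setF_neq0. Qed.

Lemma E_inj (s : F -> F) h : injective s -> E (fun x => h (s x)) = E h.
Proof.
move=> si; apply: av_reindex; first by move=> x y _ _; apply: si.
apply/eqP; by rewrite eqEcard subsetT card_imset ?leqnn.
Qed.

Lemma E_shift t h : E (fun x => h (x + t)) = E h.
Proof. by apply: (E_inj (s := fun x => x + t)); exact: addIr. Qed.

Lemma E_affine c t h : c != 0 -> E (fun x => h (t + c * x)) = E h.
Proof.
by move=> c0; apply: (E_inj (s := fun x => t + c * x)) => x y /addrI /(mulfI c0).
Qed.

Definition sqn h : R := E (fun x => h x ^+ 2).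
Definition corr u d : R := E (fun x => u x * u (x + d)).
Definition osc h t : R := sqn (fun x => h (x + t) - h x).

Lemma eq_sqn f g : f =1 g -> sqn f = sqn g.
Proof. by move=> e; apply: eq_av => x _; rewrite e. Qed.

Lemma sqn_ge0 h : 0 <= sqn h.
Proof. by apply: av_ge0 => x _; exact: sqr_ge0. Qed.

Lemma sqn_shift t h : sqn (fun x => h (x + t)) = sqn h.
Proof. exact: (E_shift t (fun x => h x ^+ 2)). Qed.

Lemma sqnN h : sqn (fun x => - h x) = sqn h.
Proof. by apply: eq_av => x _; rewrite sqrrN. Qed.

Lemma sqnD_le f g : sqn (fun x => f x + g x) <= 2 * sqn f + 2 * sqn g.
Proof.
rewrite -!avZl -avD; apply: ler_av => x _.
have := sqr_ge0 (f x - g x); nra.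
Qed.

Lemma oscN h t : osc h (- t) = osc h t.
Proof.
rewrite /osc -(sqn_shift t) -sqnN; apply: eq_sqn => x.
by rewrite addrK opprB.
Qed.

Lemma norm_E_le f (e : R) : 0 <= e -> sqn f <= e ^+ 2 -> E (fun x => `|f x|) <= e.
Proof.
move=> e0 he; rewrite -(@ler_pXn2r _ 2) ?nnegrE //; last by apply: av_ge0 => x _.
apply: le_trans (av_sqr_le _ _) _; apply: le_trans he.
by apply: eq_ler; apply: eq_av => x _; rewrite real_normK ?num_real.
Qed.

Lemma E_osc_le h t (e : R) : 0 <= e -> osc h t <= e ^+ 2 ->
  E (fun x => `|h (x + t) - h x|) <= e.
Proof. exact: norm_E_le. Qed.

(** At [d] the new autocorrelation is [2 * corr f d - corr f (d + t) - corr f (d - t)]: up to sign,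
    the increments of [corr f] by [t] and by [- t]. *)
Lemma sqn_corr_diff f t :
  sqn (corr (fun x => f (x + t) - f x)) <= 4 * osc (corr f) t.
Proof.
have -> : 4 * osc (corr f) t = 2 * osc (corr f) t + 2 * osc (corr f) (- t).
  by rewrite oscN; ring.
rewrite /osc -sqnN; apply: le_trans (sqnD_le _ _).
apply: eq_ler; apply: eq_sqn => d.
suff -> : corr (fun x => f (x + t) - f x) d = corr f d + corr f d
    - corr f (d + t) - corr f (d - t) by ring.
have -> : corr f (d - t) = E (fun x => f (x + t) * f (x + d)).
  rewrite -[LHS](E_shift t); apply: eq_av => x _; congr (_ * f _); ring.
rewrite -[X in X + corr f d](E_shift t) -!avD -!avN -!avD.
apply: eq_av => x _ /=.
have -> : x + t + d = x + d + t by ring.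
have -> : x + (d + t) = x + d + t by ring.
ring.
Qed.

End Field.

(** * Densities of weighted solutions of linear equations *)

Section Solutions.
Variables (R : realType) (F : finFieldType).
Local Notation E := (av [set: F]).
Implicit Types (f g h u : F -> R) (c w t d : F) (s r : seq (F * (F -> R))).

(* The density, relative to [#|F| ^ (size s - 1)], of the solutions of
   [c_1 x_1 + ... + c_n x_n = w] weighted by [g_1 x_1 * ... * g_n x_n], where
   [s] lists the pairs [(c_i, g_i)]; the empty list is normalised accordingly. *)
Fixpoint soldens s w : R :=
  if s is (c, g) :: s' then E (fun x => g x * soldens s' (w - c * x))
  else #|F|%:R * (w == 0)%:R.

Fixpoint bounded s : Prop :=
  if s is (c, g) :: s' then [/\ c != 0, forall x, `|g x| <= 1 & bounded s']
  else True.

Lemma bounded_cat s r : bounded (s ++ r) <-> bounded s /\ bounded r.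
Proof.
elim: s => [|[c g] s [IH1 IH2]] /=; first by split=> [|[]].
split=> [[c0 g1 /IH1[bs br]]|[[c0 g1 bs] br]]; first by split.
by split=> //; apply: IH2.
Qed.

Lemma bounded_map f (cs : seq F) : (forall x, `|f x| <= 1) -> 0 \notin cs ->
  bounded [seq (c, f) | c <- cs].
Proof.
move=> f1; elim: cs => //= c cs IH; rewrite inE negb_or => /andP[c0 cs0].
by split=> //; [rewrite eq_sym | exact: IH].
Qed.

Lemma eq_soldens_cons a s r : soldens s =1 soldens r -> soldens (a :: s) =1 soldens (a :: r).
Proof. by case: a => c g e w /=; apply: eq_av => x _; rewrite e. Qed.

Lemma soldens_swap a b s : soldens (a :: b :: s) =1 soldens (b :: a :: s).
Proof.
case: a b => [c g] [d h] w /=.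
under eq_av do rewrite -avZl.
rewrite exchange_av; apply: eq_av => y _; rewrite -avZl.
by apply: eq_av => x _; rewrite mulrCA addrAC.
Qed.

Lemma soldens_cat_cons a s r : soldens (s ++ a :: r) =1 soldens (a :: s ++ r).
Proof.
elim: s => [//|b s IH] w; rewrite cat_cons (eq_soldens_cons _ IH); exact: soldens_swap.
Qed.

Lemma soldens_catC s r : soldens (s ++ r) =1 soldens (r ++ s).
Proof.
elim: s => [|a s IH] w; first by rewrite cats0.
by rewrite soldens_cat_cons cat_cons; apply: eq_soldens_cons.
Qed.

(** Only [x = w / c] survives, and the factor [#|F|] attached to the empty list cancels the
    averaging. *)
Lemma soldens1 c g w : c != 0 -> soldens [:: (c, g)] w = g (w / c).
Proof.
move=> c0 /=; rewrite /av cardsT (bigD1 (w / c)) ?inE //= big1 ?addr0.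
  rewrite [c * _]mulrC divfK // subrr eqxx mulr1 mulfK //.
  by rewrite pnatr_eq0 -lt0n; apply/card_gt0P; exists 0.
move=> x /andP[_ xw]; rewrite subr_eq0.
suff -> : (w == c * x) = false by rewrite !mulr0.
by apply: contraNF xw => /eqP ->; rewrite mulrAC mulfV ?mul1r.
Qed.

Lemma norm_soldens_cat_le s r (B : R) : 0 <= B -> bounded s ->
  (forall w, `|soldens r w| <= B) -> forall w, `|soldens (s ++ r) w| <= B.
Proof.
move=> B0 + rB; elim: s => [//|[c g] s IH] /= [c0 g1 bs] w.
apply: norm_av_le => // x _; rewrite normrM -[B]mul1r.
by apply: ler_pM => //; exact: IH.
Qed.

Lemma norm_soldens_le s w : (0 < size s)%N -> bounded s -> `|soldens s w| <= 1.
Proof.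
case/lastP: s => // s [c g] _; rewrite -cats1 => /bounded_cat[bs [c0 g1 _]].
by apply: norm_soldens_cat_le => // w'; rewrite soldens1.
Qed.

Lemma soldens_map_ge0 f (cs : seq F) w : (forall x, 0 <= f x) ->
  0 <= soldens [seq (c, f) | c <- cs] w.
Proof.
move=> f0; elim: cs w => [|c cs IH] w /=; first by rewrite mulr_ge0.
by apply: av_ge0 => x _; apply: mulr_ge0.
Qed.

(* Cauchy-Schwarz twice: first over the unknown of [g], then over the difference
   of the two copies of the unknown of [u]. *)
Lemma soldens3_le c1 c2 c3 u g h w : c1 != 0 -> c2 != 0 -> c3 != 0 ->
  (forall x, `|g x| <= 1) -> (forall x, `|h x| <= 1) ->
  soldens [:: (c1, u); (c2, g); (c3, h)] w ^+ 4 <= sqn (corr u).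
Proof.
move=> c10 c20 c30 g1 h1.
have sq1 (a b : R) : `|a| <= 1 -> (a * b) ^+ 2 <= b ^+ 2.
  move=> a1; rewrite exprMn -[leRHS]mul1r ler_wpM2r ?sqr_ge0 //.
  by rewrite -[a ^+ 2]real_normK ?num_real // expr_le1.
(* [L x y] is the third unknown, forced by the first two. Substituting [z = L x y], affine in [y],
   turns the average over [y] of [h (L x y) * h (L (x + d) y)] into [psi d], whatever [x] is. *)
pose L x y := (w - c1 * x - c2 * y) / c3.
pose psi d := E (fun z => h z * h (z - c1 / c3 * d)).
have psi1 d : `|psi d| <= 1.
  by apply: norm_av_le => // v _; rewrite normrM mulr_ile1.
have TE : soldens [:: (c1, u); (c2, g); (c3, h)] w
          = E (fun y => g y * E (fun x => u x * h (L x y))).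
  rewrite soldens_swap [LHS]/=; apply: eq_av => y _; congr (_ * _); apply: eq_av => x _.
  by rewrite -[X in u x * X]/(soldens [:: (c3, h)] _) soldens1 // /L addrAC.
have T2 : soldens [:: (c1, u); (c2, g); (c3, h)] w ^+ 2 <= E (fun d => psi d * corr u d).
  rewrite TE; apply: le_trans (av_sqr_le _ _) _.
  apply: (@le_trans _ _ (E (fun y => E (fun x => u x * h (L x y)) ^+ 2))).
    by apply: ler_av => y _; apply: sq1.
  apply: eq_ler.
  transitivity (E (fun y => E (fun d => E (fun x =>
     u x * u (x + d) * (h (L x y) * h (L (x + d) y)))))).
    apply: eq_av => y _; rewrite expr2 -avZl [RHS]exchange_av.
    apply: eq_av => x _; rewrite -[X in X * _](E_shift x) mulrC -avZl.
    by apply: eq_av => d _; rewrite [d + x]addrC; ring.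
  rewrite exchange_av; apply: eq_av => d _.
  rewrite exchange_av /corr -avZl; apply: eq_av => x _.
  rewrite avZl mulrC; congr (_ * _).
  rewrite /psi -[RHS](E_affine (c := - c2 / c3) ((w - c1 * x) / c3)).
    by apply: eq_av => y _; rewrite /L; congr (h _ * h _); field.
  by rewrite mulf_neq0 ?oppr_eq0 ?invr_eq0.
rewrite (exprM _ 2 2); apply: (@le_trans _ _ (E (fun d => psi d * corr u d) ^+ 2)).
  by rewrite ler_pXn2r ?nnegrE ?sqr_ge0 // (le_trans _ T2) ?sqr_ge0.
apply: le_trans (av_sqr_le _ _) _.
by apply: ler_av => d _; apply: sq1.
Qed.

(** Three unknowns suffice: the others are moved to the front, where averaging against weights
    bounded by 1 does not increase the maximum. *)
Lemma norm_soldens_corr_le c u s w (k : R) : c != 0 -> bounded s -> (1 < size s)%N ->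
  0 <= k -> sqn (corr u) <= k ^+ 4 -> `|soldens ((c, u) :: s) w| <= k.
Proof.
case: s => [//|[c2 g] [//|[c3 h] s]] c0 [c20 g1 [c30 h1 bs]] _ k0 uk.
rewrite -[_ :: _]/([:: (c, u); (c2, g); (c3, h)] ++ s) soldens_catC.
apply: norm_soldens_cat_le => // w'.
rewrite -(@ler_pXn2r _ 4) ?nnegrE ?normr_ge0 // -normrX ger0_norm.
  by apply: le_trans uk; apply: soldens3_le.
by rewrite (exprM _ 2 2) sqr_ge0.
Qed.

Lemma soldens_shift c f s w t :
  soldens ((c, f) :: s) (w + c * t) = soldens ((c, fun x => f (x + t)) :: s) w.
Proof.
rewrite /= -[LHS](E_shift t); apply: eq_av => x _; congr (_ * soldens _ _); ring.
Qed.

Lemma soldens_consB c f g s w :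
  soldens ((c, fun x => f x - g x) :: s) w = soldens ((c, f) :: s) w - soldens ((c, g) :: s) w.
Proof. by rewrite /= -avB; apply: eq_av => x _; rewrite mulrBl. Qed.

Lemma soldens_cons_av (I : finType) (S : {set I}) (f : I -> F -> R) c s w :
  soldens ((c, fun x => av S (f^~ x)) :: s) w = av S (fun i => soldens ((c, f i) :: s) w).
Proof.
rewrite /= [RHS]exchange_av; apply: eq_av => x _; rewrite -avZr; exact: eq_av.
Qed.

Lemma norm_soldens_osc_le c f s w t (k : R) : c != 0 -> bounded s -> (1 < size s)%N ->
  0 <= k -> 4 * osc (corr f) t <= k ^+ 4 ->
  `|soldens ((c, fun x => f (x + t) - f x) :: s) w| <= k.
Proof.
move=> c0 bs s1 k0 hk; apply: norm_soldens_corr_le => //.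
exact: le_trans (sqn_corr_diff _ _) hk.
Qed.

(* Swap [f] for [f'] one coordinate at a time. *)
Lemma norm_soldens_replace_le f f' (k : R) : (forall x, `|f x| <= 1) ->
  (forall x, `|f' x| <= 1) ->
  (forall c s w, c != 0 -> bounded s -> (1 < size s)%N ->
     `|soldens ((c, fun x => f' x - f x) :: s) w| <= k) ->
  forall cs w, 0 \notin cs -> (2 < size cs)%N ->
  `|soldens [seq (c, f') | c <- cs] w - soldens [seq (c, f) | c <- cs] w| <= (size cs)%:R * k.
Proof.
move=> f1 f'1 hk.
(* The prefix [cs1] already carries [f'], so that the induction on [cs2] swaps one weight at a
   time. *)
suff H : forall cs2 cs1 w, 0 \notin cs1 ++ cs2 -> (2 < size (cs1 ++ cs2))%N ->
  `|soldens ([seq (c, f') | c <- cs1] ++ [seq (c, f') | c <- cs2]) w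
    - soldens ([seq (c, f') | c <- cs1] ++ [seq (c, f) | c <- cs2]) w| <= (size cs2)%:R * k.
  by move=> cs w; apply: (H cs [::]).
elim=> [|c cs2 IH] cs1 w; first by rewrite subrr normr0 mul0r.
move=> n0 sz /=; have := n0.
rewrite mem_cat inE !negb_or => /and3P[cs1_0 c_0 cs2_0].
have := IH (rcons cs1 c) w; rewrite cat_rcons => /(_ n0 sz).
rewrite map_rcons !cat_rcons => H.
rewrite -natr1 mulrDl mul1r; apply: le_trans (ler_distD _ _ _) _.
apply: lerD; first exact: H.
rewrite !soldens_cat_cons -soldens_consB; apply: hk; first by rewrite eq_sym.
  by apply/bounded_cat; split; apply: bounded_map.
by move: sz; rewrite !size_cat !size_map /= addnS.
Qed.

End Solutions.

(** * Solutions near the diagonal, from almost periods of [g] *)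

Section Positivity.
Variables (R : realType) (F : finFieldType).
Local Notation E := (av [set: F]).
Variables (f g : F -> R) (k : R).
Hypotheses (f0 : forall x, 0 <= f x) (f1 : forall x, f x <= 1).
Hypotheses (g0 : forall x, 0 <= g x) (g1 : forall x, g x <= 1).
Hypothesis fg : E (fun x => `|f x - g x|) <= k.

Let D z := E (fun x => `|g (x + z) - g x|).

Let D_add a b : D (a + b) <= D a + D b.
Proof.
rewrite /D -[X in _ <= _ + X](E_shift a) -avD.
apply: ler_av => x _; rewrite addrA [leRHS]addrC; exact: ler_distD.
Qed.

Let D0 : D 0 = 0.
Proof.
rewrite -(@E_cst R F 0); apply: eq_av => x _.
by rewrite addr0 subrr normr0.
Qed.

(** Replacing [f] by [g] costs [k], and undoing the translation costs [D z]. *)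
Lemma E_mul_close (psi : F -> R) z : (forall x, 0 <= psi x <= 1) ->
  E (fun x => psi x * g x) - k - D z <= E (fun x => psi x * f (x + z)).
Proof.
move=> psi01.
suff : E (fun x => psi x * g x - psi x * f (x + z)) <= k + D z.
  by rewrite avB; lra.
apply: le_trans (lerD fg (lexx _)).
rewrite -[X in _ <= X + _](E_shift z) -avD.
apply: ler_av => x _; rewrite -mulrBr.
have /andP[p0 p1] := psi01 x.
apply: (@le_trans _ _ `|g x - f (x + z)|).
  apply: le_trans (ler_norm _) _; rewrite normrM.
  by apply: ler_piMl => //; rewrite ger0_norm.
rewrite distrC.
exact: ler_distD.
Qed.

(** The unknown of each [c] in [cs] is taken to be [x + c2 * t] with [t] in [Q]; this moves the last
    unknown from [x + z] to [x + (z - c * t)]. The dilation by [c2] is what makes the last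
    displacement division-free. Each unknown costs a factor [tau] for restricting to [Q], and
    [3 * k]: one [k] for [f] against [g], one for [D (c2 * t)], one for the change of [z]. [phi]
    collects the weights already chosen. *)
Lemma E_mul_soldens_ge (c2 : F) (Q : {set F}) (tau : R) : c2 != 0 -> 0 <= tau ->
  tau * #|F|%:R <= #|Q|%:R -> (forall t, t \in Q -> D (c2 * t) <= k) ->
  forall cs (phi : F -> R) z,
    (forall x, 0 <= phi x <= 1) ->
    (forall c t, c \in cs -> t \in Q -> D (- c * t) <= k) ->
  tau ^+ size cs * (E (fun x => phi x * g x ^+ (size cs).+1)
                    - ((3 * size cs).+1%:R * k + D z)) <=
  E (fun x => phi x * soldens [seq (c, f) | c <- rcons cs c2]
                        ((c2 + \sum_(c <- cs) c) * x + c2 * z)).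
Proof.
move=> c20 tau0 Qtau Qc2; elim=> [|c cs IH] phi z phi01 Qcs.
  rewrite big_nil expr0 mul1r mul1r /= opprD addrA.
  apply: le_trans (E_mul_close z phi01) _; apply: eq_ler; apply: eq_av => x _.
  rewrite -[X in _ = _ * X]/(soldens [:: (c2, f)] _) soldens1 //; congr (_ * f _).
  by field.
rewrite /= big_cons.
have -> : E (fun x => phi x * E (fun y => f y * soldens [seq (c, f) | c <- rcons cs c2]
             ((c2 + (c + \sum_(j <- cs) j)) * x + c2 * z - c * y))) =
  E (fun t => E (fun x => (phi x * f (x + c2 * t)) *
      soldens [seq (c, f) | c <- rcons cs c2] ((c2 + \sum_(j <- cs) j) * x + c2 * (z - c * t)))).
  rewrite exchange_av; apply: eq_av => x _.
  rewrite -[X in _ * X](E_affine x _ c20) -avZl; apply: eq_av => t _.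
  rewrite mulrA; congr (_ * soldens _ _); ring.
rewrite exprS -mulrA; apply: av_restrict Qtau => //.
- by apply/card_gt0P; exists 0.
- move=> t; apply: av_ge0 => x _; apply: mulr_ge0; last exact: soldens_map_ge0.
  by rewrite mulr_ge0 //; case/andP: (phi01 x).
move=> t tQ.
have phi'01 x : 0 <= phi x * f (x + c2 * t) <= 1.
  by case/andP: (phi01 x) => p0 p1; rewrite mulr_ge0 // mulr_ile1.
have Qcs' c' t' : c' \in cs -> t' \in Q -> D (- c' * t') <= k.
  by move=> c'cs; apply: Qcs; rewrite inE c'cs orbT.
apply: le_trans (IH _ (z - c * t) phi'01 Qcs').
apply: ler_wpM2l; first exact: exprn_ge0.
have psi01 x : 0 <= phi x * g x ^+ (size cs).+1 <= 1.
  case/andP: (phi01 x) => p0 p1; have gn0 : 0 <= g x ^+ (size cs).+1 by exact: exprn_ge0.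
  by rewrite mulr_ge0 // mulr_ile1 // exprn_ile1.
have H1 := E_mul_close (c2 * t) psi01.
have H2 := Qc2 t tQ.
have H3 : D (z - c * t) <= D z + k.
  by apply: le_trans (D_add _ _) _; rewrite lerD2l -mulNr Qcs ?inE ?eqxx.
have e1 : E (fun x => phi x * g x ^+ (size cs).+1 * g x) = E (fun x => phi x * g x ^+ (size cs).+2).
  by apply: eq_av => x _; rewrite -mulrA -exprSr.
have e2 : E (fun x => phi x * g x ^+ (size cs).+1 * f (x + c2 * t))
        = E (fun x => phi x * f (x + c2 * t) * g x ^+ (size cs).+1).
  by apply: eq_av => x _; rewrite mulrAC.
rewrite e1 e2 in H1.
have e3 : (3 * (size cs).+1).+1%:R * k = (3 * size cs).+1%:R * k + 3 * k.
  by rewrite mulnS -addnS natrD; ring.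
rewrite e3; lra.
Qed.

(** Pointwise, [g ^+ n.+1] is at least [(a / 2) ^+ n * (g - a / 2)], whose average is at least the
    claimed bound. *)
Lemma E_exp_ge (a : R) n : 0 <= a -> a <= E g -> (a / 2) ^+ n.+1 <= E (fun x => g x ^+ n.+1).
Proof.
move=> a0 ag; apply: (@le_trans _ _ (E (fun x => (a / 2) ^+ n * (g x - a / 2)))).
  rewrite avZl exprSr ler_wpM2l ?exprn_ge0 ?divr_ge0 //.
  by rewrite avB E_cst; lra.
apply: ler_av => x _; rewrite exprSr.
have [h|h] := leP (a / 2) (g x).
  apply: ler_pM; rewrite ?exprn_ge0 ?subr_ge0 ?divr_ge0 //; last first.
    by rewrite gerBl divr_ge0.
  by case: n => // n; rewrite ler_pXn2r ?nnegrE ?divr_ge0.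
apply: (@le_trans _ _ 0); last by rewrite mulr_ge0 ?exprn_ge0.
by rewrite mulr_ge0_le0 ?exprn_ge0 ?divr_ge0 // subr_le0 ltW.
Qed.

(** As the coefficients sum to 0, the first unknown can serve as the base point [x]: take [phi := f]
    and [z := 0]. Replacing this last [f] by [g] costs one more [k]. *)
Lemma soldens_ge (c1 c2 : F) cs (Q : {set F}) (tau a : R) : c2 != 0 -> 0 <= tau ->
  tau * #|F|%:R <= #|Q|%:R -> c1 + (\sum_(c <- cs) c + c2) = 0 ->
  0 <= a -> a <= E g ->
  (forall t, t \in Q -> D (c2 * t) <= k) ->
  (forall c t, c \in cs -> t \in Q -> D (- c * t) <= k) ->
  tau ^+ size cs * ((a / 2) ^+ (size cs).+2 - (3 * size cs).+2%:R * k) <=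
  soldens [seq (c, f) | c <- c1 :: rcons cs c2] 0.
Proof.
move=> c20 tau0 Qtau c_sum a0 ag Q2 Qcs.
have f01 x : 0 <= f x <= 1 by rewrite f0 f1.
have := E_mul_soldens_ge c20 tau0 Qtau Q2 (phi := f) 0 f01 Qcs.
have -> : E (fun x => f x * soldens [seq (c, f) | c <- rcons cs c2]
            ((c2 + \sum_(c <- cs) c) * x + c2 * 0)) = soldens [seq (c, f) | c <- c1 :: rcons cs c2] 0.
  apply: eq_av => x _; congr (_ * soldens _ _).
  have -> : c1 = - (\sum_(c <- cs) c + c2) by apply/eqP; rewrite -addr_eq0 c_sum.
  by rewrite mulr0 addr0 sub0r -mulNr opprK addrC.
apply: le_trans; apply: ler_wpM2l; first exact: exprn_ge0.
have psi01 x : 0 <= g x ^+ (size cs).+1 <= 1.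
  by rewrite exprn_ge0 // exprn_ile1.
have := E_mul_close 0 psi01; rewrite D0 subr0 addr0.
have -> : E (fun x => g x ^+ (size cs).+1 * g x) = E (fun x => g x ^+ (size cs).+2).
  by apply: eq_av => x _; rewrite -exprSr.
have -> : E (fun x => g x ^+ (size cs).+1 * f (x + 0)) = E (fun x => f x * g x ^+ (size cs).+1).
  by apply: eq_av => x _; rewrite addr0 mulrC.
have := E_exp_ge (size cs).+1 a0 ag.
have -> : (3 * size cs).+2%:R * k = (3 * size cs).+1%:R * k + k.
  by rewrite -[(3 * size cs).+2%:R]natr1 mulrDl mul1r.
lra.
Qed.

End Positivity.

(** * Random samples, Markov's inequality and colouring by a net *)

Section Sampling.
Variables (R : realType) (X : finType).

(** Iterated products let [av_setX] peel off one sample at a time. *)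
Fixpoint tup (m : nat) : finType :=
  if m is m'.+1 then (X * tup m')%type else unit.

Fixpoint tset (S : {set X}) m : {set tup m} :=
  if m is m'.+1 then setX S (tset S m') else [set: unit].

Fixpoint tsum (a : X -> R) m : tup m -> R :=
  if m is m'.+1 then fun b => a b.1 + tsum a b.2 else fun=> 0.

Lemma card_tup m : #|tup m| = (#|X| ^ m)%N.
Proof. by elim: m => [|m IH]; rewrite ?card_unit // card_prod IH expnS. Qed.

Lemma card_tset S m : #|tset S m| = (#|S| ^ m)%N.
Proof.
by elim: m => [|m IH] /=; rewrite ?cardsT ?card_unit // cardsX IH expnS.
Qed.

Lemma tset_neq0 (S : {set X}) m : S != set0 -> tset S m != set0.
Proof. by rewrite -!card_gt0 card_tset expn_gt0 => ->. Qed.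

(** Variances of independent samples add: the cross term vanishes because [a - mu] has average 0 on
    [S], and each sample contributes at most 4. *)
Lemma tsum_variance (S : {set X}) (a : X -> R) (mu : R) m : S != set0 ->
  av S a = mu -> (forall s, s \in S -> `|a s - mu| <= 2) ->
  av (tset S m) (fun b => (tsum a b - m%:R * mu) ^+ 2) <= 4 * m%:R.
Proof.
move=> S0 amu a2; elim: m => [|m IH].
  apply: av_le; first by rewrite mulr0.
  by move=> b _ /=; rewrite mul0r subr0 expr0n mulr0.
rewrite [tset S _]/= av_setX.
pose t b := tsum a (m := m) b - m%:R * mu.
have -> : av S (fun s => av (tset S m) (fun b => (tsum a ((s, b) : tup m.+1) - m.+1%:R * mu) ^+ 2))
  = av S (fun s => (a s - mu) ^+ 2) + av (tset S m) (fun b => t b ^+ 2).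
  transitivity (av S (fun s => (a s - mu) ^+ 2 + 2 * av (tset S m) t * (a s - mu)
     + av (tset S m) (fun b => t b ^+ 2))).
    apply: eq_av => s _.
    rewrite -[(a s - mu) ^+ 2](av_cst _ (tset_neq0 m S0)) -avZl -avZr -!avD.
    by apply: eq_av => b _; rewrite /t /= -[m.+1%:R]natr1; ring.
  have a0 : av S (fun s => a s - mu) = 0 by rewrite avB amu av_cst ?subrr.
  by rewrite !avD avZl a0 mulr0 addr0 av_cst.
rewrite -[m.+1%:R]natr1 mulrDr mulr1 addrC; apply: lerD => //.
apply: av_le => // s sS; rewrite -real_normK ?num_real //.
have : 0 <= `|a s - mu| <= 2 by rewrite normr_ge0 a2.
by nra.
Qed.

End Sampling.

(** Markov's inequality: [q] exceeds twice its bound on at most half of [Y]. *)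
Lemma card_le_double (R : realType) (X : finType) (Y : {set X}) (q : X -> R) (B : R) :
  0 < B -> (forall b, 0 <= q b) -> av Y q <= B ->
  (#|Y| <= 2 * #|[set b in Y | (q b <= B * 2)%R]|)%N.
Proof.
move=> B0 q0; have [->|Y0] := eqVneq Y set0; first by rewrite cards0.
have Ypos : (0 : R) < #|Y|%:R by rewrite ltr0n card_gt0.
rewrite /av ler_pdivrMr // => hq.
set G := [set b in Y | _]; set Z := [set b in Y | ~~ (q b <= B * 2)].
have cYZ : (#|G| + #|Z|)%N = #|Y|.
  rewrite -(cardsID G Y); congr (_ + _)%N; apply: eq_card => b; rewrite !inE.
    by case: (b \in Y).
  by case: (b \in Y); rewrite ?andbT ?andbF.
suff : (2 * #|Z| <= #|Y|)%N by lia.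
have : B * 2 * #|Z|%:R <= B * #|Y|%:R.
  apply: le_trans hq.
  apply: (@le_trans _ _ (\sum_(b in Z) q b)).
    rewrite mulr_natr -sumr_const; apply: ler_sum => b.
    by rewrite inE => /andP[_]; rewrite -ltNge => /ltW.
  rewrite [leRHS](bigID (mem Z)) /= -[leLHS]addr0 lerD ?sumr_ge0 //.
  by apply: eq_ler; apply: eq_bigl => b; rewrite inE; case: (b \in Y).
by rewrite -mulrA ler_pM2l // -natrM ler_nat.
Qed.

(** A largest separated set is also a net, since a point far from all its members could be added.
    Each point is coloured by a member close to it. *)
Lemma separated_colouring (X : finType) (M : nat) (close : rel X) :
  reflexive close -> symmetric close ->
  (forall U : {set X}, {in U &, forall u v, u != v -> ~~ close u v} -> (#|U| <= M)%N) ->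
  exists col : X -> 'I_M.+1,
    forall u v, col u = col v -> exists2 z, close u z & close z v.
Proof.
move=> cr cs hM.
pose sep (U : {set X}) := [forall u in U, forall v in U, (u != v) ==> ~~ close u v].
have sepP (U : {set X}) : reflect {in U &, forall u v, u != v -> ~~ close u v} (sep U).
  apply: (iffP idP) => [/forall_inP h u v uU vU uv|h].
    by move/forall_inP: (h u uU) => /(_ v vU) /implyP; apply.
  apply/forall_inP => u uU; apply/forall_inP => v vU; apply/implyP; exact: h.
have sep0 : sep set0 by apply/sepP => u v; rewrite inE.
case: (arg_maxnP (fun U : {set X} => #|U|) sep0) => U /sepP sU maxU.
have near v : exists u, (u \in U) && close u v.
  apply/existsP; apply: contraT => /existsPn far.
  have vU : v \notin U by apply: contraT; rewrite negbK => vU; have := far v; rewrite vU cr.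
  have : sep (v |: U).
    apply/sepP => a b; rewrite !inE => /orP[/eqP ->|aU] /orP[/eqP ->|bU].
    - by rewrite eqxx.
    - by move=> _; have := far b; rewrite bU cs.
    - by move=> _; have := far a; rewrite aU.
    - exact: sU.
  by move/maxU; rewrite /= cardsU1 vU ltnn.
pose nb v := xchoose (near v).
have nbP v : (nb v \in U) && close (nb v) v by exact: (xchooseP (near v)).
exists (fun v => inord (index (nb v) (enum U))) => u v /(congr1 val) /=.
have idx w : (index (nb w) (enum U) < M.+1)%N.
  apply: (@leq_trans #|U|); last by apply: leqW; apply: hM.
  by rewrite cardE index_mem mem_enum; case/andP: (nbP w).
rewrite !inordK // => e.
have enb : nb u = nb v.
  by rewrite -[nb u](nth_index u (s := enum U)) ?e ?nth_index ?mem_enum //;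
    [case/andP: (nbP v) | case/andP: (nbP u)].
exists (nb u); first by rewrite cs; case/andP: (nbP u).
by rewrite enb; case/andP: (nbP v).
Qed.

(** * Colourings whose classes have almost periods as differences *)

Section Oscillation.
Variables (R : realType).

Lemma osc0 (F : finFieldType) (g : F -> R) : osc g 0 = 0.
Proof.
rewrite -(@E_cst R F 0); apply: eq_av => x _; by rewrite addr0 subrr expr0n.
Qed.

Lemma osc_addr_le (F : finFieldType) (g : F -> R) a b :
  osc g (a + b) <= 2 * osc g a + 2 * osc g b.
Proof.
rewrite /osc -[X in 2 * X + _](sqn_shift b); apply: le_trans (sqnD_le _ _).
by apply: eq_ler; apply: eq_sqn => x; rewrite [a + b]addrC addrA subrKA.
Qed.

Lemma osc_sub (F : finFieldType) (g : F -> R) u v :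
  osc g (u - v) = sqn (fun x => g (x + u) - g (x + v)).
Proof.
rewrite /osc -(sqn_shift v); apply: eq_sqn => x.
by rewrite -addrA [v + _]addrC subrK.
Qed.

Definition sm (F : finFieldType) (S : {set F}) (h : F -> R) : F -> R :=
  fun x => av S (fun s => h (x + s)).

Lemma norm_sm_le (F : finFieldType) (S : {set F}) (h : F -> R) :
  (forall x, `|h x| <= 1) -> forall x, `|sm S h x| <= 1.
Proof. by move=> h1 x; apply: norm_av_le. Qed.

(* The sampling argument of Croot and Sisask: an average of [m] random translates
   of [h] approximates [sm S h] in mean square, and translates of [sm S h] that
   share an approximating sample are close to each other. *)
Lemma osc_colouring (N : nat) (eta : R) : 0 < eta -> exists M : nat,
  forall (F : finFieldType) (h : F -> R) (S : {set F}),
    (forall x, `|h x| <= 1) -> (#|F| <= N * #|S|)%N ->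
  exists col : F -> 'I_M.+1,
    forall u v, col u = col v -> osc (sm S h) (u - v) <= eta.
Proof.
move=> eta0.
(* A good sample has squared error at most [8 * m]. Two translates sharing one differ, after scaling
   by [m], by at most [32 * m] in mean square, hence by [32 / m < eta / 4] without scaling. *)
pose m := Num.bound (128 / eta).
have mP : 128 / eta < m%:R by apply: archi_boundP; rewrite divr_ge0 // ltW.
have m0 : (0 : R) < m%:R by apply: le_lt_trans mP; rewrite divr_ge0 // ltW.
(* Separated points have disjoint sets of good samples, each of size at least [#|S| ^ m / 2], among
   [#|F| ^ m <= N ^ m * #|S| ^ m] samples. *)
exists (2 * N ^ m)%N => F h S h1 FS.
have Fpos : (0 < #|F|)%N by apply/card_gt0P; exists 0.
have S0 : S != set0.
  by apply: contraTneq FS => ->; rewrite cards0 muln0 -ltnNge.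
pose g := sm S h.
(* Passing through a common close point gives [2 * (eta / 4) + 2 * (eta / 4)]. *)
pose close u v := osc g (u - v) <= eta / 4.
have close_refl : reflexive close.
  by move=> u; rewrite /close subrr osc0 divr_ge0 // ltW.
have close_sym : symmetric close by move=> u v; rewrite /close -oscN opprB.
(* Sampling from [S + u] approximates [g (. + u)], so the samples of all translates live in the same
   space and can coincide. *)
pose Su u := [set s + u | s in S].
have cSu u : #|Su u| = #|S| by rewrite card_imset //; exact: addIr.
have Su0 u : Su u != set0 by rewrite -card_gt0 cSu card_gt0.
have gu u x : av (Su u) (fun s => h (x + s)) = g (x + u).
  rewrite -(av_reindex (S' := S) (f := fun s => s + u)) //; last first.
    by move=> s t _ _; exact: addIr.
  by apply: eq_av => s _; rewrite -addrA [u + s]addrC.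
pose q u (b : tup F m) := sqn (fun x => tsum (fun s => h (x + s)) b - m%:R * g (x + u)).
pose Good u := [set b in tset (Su u) m | q u b <= 4 * m%:R * 2].
have hGood u : (#|S| ^ m <= 2 * #|Good u|)%N.
  rewrite -(cSu u) -card_tset; apply: card_le_double.
  - by rewrite mulr_gt0.
  - by move=> b; exact: sqn_ge0.
  - rewrite /q /sqn exchange_av; apply: av_le; first by rewrite mulr_ge0 // ltW.
    move=> x _; apply: tsum_variance (Su0 u) (gu u x) _ => s _.
    apply: le_trans (ler_normB _ _) _.
    by apply: lerD => //; apply: norm_sm_le.
have overlap u v b : b \in Good u -> b \in Good v -> close u v.
  rewrite !inE => /andP[_ qu] /andP[_ qv]; rewrite /close osc_sub.
  have : sqn (fun x => m%:R * (g (x + u) - g (x + v))) <= 32 * m%:R.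
    pose a w x := tsum (fun s => h (x + s)) b - m%:R * g (x + w).
    rewrite (@eq_sqn _ _ _ (fun x => a v x + - a u x)); last first.
      by move=> x; rewrite /a; ring.
    apply: le_trans (sqnD_le _ _) _; rewrite sqnN.
    rewrite /q -/(a u) -/(a v) in qu qv.
    lra.
  rewrite /sqn; under eq_av do rewrite exprMn.
  rewrite avZl; set V := av _ _ => hV.
  have {}hV : m%:R * V <= 32 by rewrite -(ler_pM2l m0) mulrA -expr2 [_ * 32]mulrC.
  have hm : 128 < m%:R * eta by rewrite -ltr_pdivrMr.
  have V0 : 0 <= V by apply: av_ge0 => x _; exact: sqr_ge0.
  rewrite ler_pdivlMr //.
  rewrite -(ler_pM2l m0); lra.
have sepM (U : {set F}) : {in U &, forall u v, u != v -> ~~ close u v} ->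
    (#|U| <= 2 * N ^ m)%N.
  move=> sU.
  have cU : (\sum_(u in U) #|Good u| <= #|F| ^ m)%N.
    rewrite -card_tup -sum1_card.
    under eq_bigr do rewrite -sum1_card big_mkcond.
    rewrite exchange_big /=; apply: leq_sum => b _.
    rewrite -big_mkcondr sum1_card; apply/card_le1P => u.
    rewrite unfold_in => /andP[uU bu] v; rewrite !inE.
    apply/idP/eqP => [/andP[vU bv]|->]; last exact/andP.
    apply/eqP; apply: contraT => uv.
    by have := sU _ _ vU uU uv; rewrite (overlap _ _ b).
  have Sm : (0 < #|S| ^ m)%N by rewrite expn_gt0 card_gt0 S0.
  rewrite -(leq_pmul2r Sm) -mulnA -expnMn.
  apply: (@leq_trans (2 * #|F| ^ m)); last by rewrite leq_mul2l leq_exp2r ?FS ?orbT //.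
  apply: leq_trans (leq_mul (leqnn 2) cU).
  rewrite -sum_nat_const big_distrr /=; exact: leq_sum.
have [col hcol] := separated_colouring close_refl close_sym sepM.
exists col => u v /hcol[z uz zv].
have -> : u - v = (u - z) + (z - v) by rewrite subrKA.
apply: le_trans (osc_addr_le _ _ _) _.
rewrite /close in uz zv; lra.
Qed.

End Oscillation.

(** * Smoothing over differences and its energy *)

Section Smoothing.
Variables (R : realType) (F : finFieldType).
Local Notation E := (av [set: F]).
Implicit Types (f g h : F -> R) (S A : {set F}).

Definition smN S f : F -> R := fun x => av S (fun s => f (x - s)).
(** Both averages together run over differences [s - s'] in [S]. This makes [energy] the mean square
    of [smN S f], and leaves [smooth S f] in the form [sm S h] that [osc_colouring] handles. *)
Definition smooth S f : F -> R := sm S (smN S f).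
Definition energy S f : R := E (fun x => f x * smooth S f x).
Definition ind A : F -> R := fun x => (x \in A)%:R.

Lemma ind01 A x : 0 <= ind A x <= 1.
Proof. by rewrite /ind; case: (x \in A); rewrite ?lexx ?ler01. Qed.

Lemma norm_ge0_le1 (a : R) : 0 <= a <= 1 -> `|a| <= 1.
Proof. by case/andP=> a0 a1; rewrite ger0_norm. Qed.

Lemma smN01 S f : (forall x, 0 <= f x <= 1) -> forall x, 0 <= smN S f x <= 1.
Proof.
move=> f01 x; apply/andP; split.
  by apply: av_ge0 => s _; case/andP: (f01 (x - s)).
by apply: av_le => // s _; case/andP: (f01 (x - s)).
Qed.

Lemma smooth01 S f : (forall x, 0 <= f x <= 1) -> forall x, 0 <= smooth S f x <= 1.
Proof.
move=> /(smN01 S) f01 x; apply/andP; split.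
  by apply: av_ge0 => s _; case/andP: (f01 (x + s)).
by apply: av_le => // s _; case/andP: (f01 (x + s)).
Qed.

Lemma smoothE S f x : smooth S f x = av S (fun s => av S (fun s' => f (x + (s - s')))).
Proof. by apply: eq_av => s _; apply: eq_av => s' _; rewrite addrA. Qed.

Lemma E_smooth S f : S != set0 -> E (smooth S f) = E f.
Proof.
move=> S0; rewrite /smooth /sm exchange_av -[RHS](av_cst _ S0).
apply: eq_av => s _; rewrite (E_shift s (smN S f)) exchange_av -[RHS](av_cst _ S0).
by apply: eq_av => s' _; rewrite (E_shift (- s')).
Qed.

Lemma energy_smN S f : energy S f = sqn (smN S f).
Proof.
rewrite /energy /smooth /sm; under eq_av do rewrite -avZl.
rewrite exchange_av.
transitivity (av S (fun s => E (fun x => f (x - s) * smN S f x))).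
  apply: eq_av => s _; rewrite -[LHS](E_shift (- s)).
  by apply: eq_av => x _; rewrite subrK.
by rewrite exchange_av; apply: eq_av => x _; rewrite avZr expr2.
Qed.

Lemma sqn_sm_le S h : sqn (sm S h) <= sqn h.
Proof.
apply: (@le_trans _ _ (E (fun x => av S (fun s => h (x + s) ^+ 2)))).
  by apply: ler_av => x _; exact: av_sqr_le.
rewrite exchange_av; apply: av_le; first exact: sqn_ge0.
by move=> s _; rewrite (E_shift s (fun x => h x ^+ 2)).
Qed.

Lemma sqn_smooth_le S f : sqn (smooth S f) <= energy S f.
Proof. by rewrite energy_smN; exact: sqn_sm_le. Qed.

Lemma energy_ge0 S f : 0 <= energy S f.
Proof. by rewrite energy_smN; exact: sqn_ge0. Qed.

Lemma energy_le1 S f : (forall x, 0 <= f x <= 1) -> energy S f <= 1.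
Proof.
move=> f01; rewrite energy_smN; apply: av_le => // x _.
by have /andP[g0 g1] := smN01 S f01 x; rewrite expr_le1.
Qed.

(** Each translation by [s - s'] is moved from [f] to [g], where it costs at most [k]. *)
Lemma E_smooth_mul_ge S f g (k : R) : (forall x, 0 <= f x <= 1) -> S != set0 -> 0 <= k ->
  {in S &, forall s s', osc g (s - s') <= k ^+ 2} ->
  E (fun x => f x * g x) - k <= E (fun x => smooth S f x * g x).
Proof.
move=> f01 S0 k0 hk.
have -> : E (fun x => smooth S f x * g x)
  = av S (fun s => av S (fun s' => E (fun x => f x * g (x - (s - s'))))).
  transitivity (E (fun x => av S (fun s => av S (fun s' => f (x + (s - s')) * g x)))).
    by apply: eq_av => x _; rewrite smoothE -avZr; apply: eq_av => s _; rewrite -avZr.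
  rewrite exchange_av; apply: eq_av => s _; rewrite exchange_av; apply: eq_av => s' _.
  rewrite -[RHS](E_shift (s - s')); apply: eq_av => x _; by rewrite addrK.
rewrite -[leLHS](av_cst _ S0); apply: ler_av => s sS.
rewrite -[leLHS](av_cst _ S0); apply: ler_av => s' s'S.
suff : E (fun x => f x * g x - f x * g (x - (s - s'))) <= k by rewrite avB; lra.
have : E (fun x => `|g (x + (s' - s)) - g x|) <= k by apply: E_osc_le => //; exact: hk.
apply: le_trans; apply: ler_av => x _; rewrite opprB -mulrBr distrC.
have /andP[f0 f1] := f01 x.
apply: le_trans (ler_norm _) _; rewrite normrM ler_piMl // ger0_norm //.
Qed.

(* If no energy is gained from [S] to the finer [S'], the two smoothings are close. *)
Lemma sqn_smoothB_le S S' f (k : R) : (forall x, 0 <= f x <= 1) -> S' != set0 -> 0 <= k ->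
  {in S' &, forall s s', osc (smooth S f) (s - s') <= k ^+ 2} ->
  sqn (fun x => smooth S' f x - smooth S f x) <= energy S' f - energy S f + 2 * k.
Proof.
move=> f01 S'0 k0 hk.
have -> : sqn (fun x => smooth S' f x - smooth S f x)
  = sqn (smooth S' f) - 2 * E (fun x => smooth S' f x * smooth S f x) + sqn (smooth S f).
  rewrite /sqn -avZl -avB -avD; apply: eq_av => x _; ring.
(* The cross term is at least [energy S f - k], and both squares are at most the corresponding
   energies. *)
have := E_smooth_mul_ge f01 S'0 k0 hk; rewrite -/(energy S f).
have := sqn_smooth_le S f; have := sqn_smooth_le S' f; lra.
Qed.

(** [corr (ind A)] is [sm A (ind A)] times the density of [A], which is at most 1. So the sampling
    argument applies to autocorrelations of indicators. *)
Lemma osc_corr_ind_le A t : osc (corr (ind A)) t <= osc (sm A (ind A)) t.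
Proof.
have cE d : corr (ind A) d = (#|A|%:R / #|F|%:R) * sm A (ind A) d.
  have [->|A0] := eqVneq A set0.
    rewrite cards0 !mul0r -(@E_cst R F 0).
    by apply: eq_av => x _; rewrite /ind inE mul0r.
  rewrite /corr /sm /av cardsT [RHS]mulrC mulrA divfK ?pnatr_eq0 ?cards_eq0 //.
  congr (_ / _); rewrite [RHS]big_mkcond; apply: eq_big => [x|x _]; first by rewrite inE.
  by rewrite /ind addrC; case: (x \in A); rewrite ?mul1r ?mul0r.
apply: ler_av => x _; rewrite !cE -mulrBr exprMn ler_piMl ?sqr_ge0 //.
rewrite expr_le1 //; last by rewrite divr_ge0.
rewrite ler_pdivrMr ?mul1r ?ler_nat ?max_card // ltr0n.
by apply/card_gt0P; exists 0.
Qed.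

Lemma E_ind A : E (ind A) = #|A|%:R / #|F|%:R.
Proof.
rewrite /av cardsT -sum1_card natr_sum; congr (_ / _).
rewrite [RHS]big_mkcond; apply: eq_big => [x|x _]; first by rewrite inE.
by rewrite /ind; case: (x \in A).
Qed.

(** [smooth S f - f] is an average of increments of [f] by [a - b], each controlled by
    [norm_soldens_osc_le]. *)
Lemma norm_soldens_smooth_le S f c s w (k : R) : c != 0 -> bounded s -> (1 < size s)%N ->
  0 <= k -> S != set0 -> {in S &, forall a b, 4 * osc (corr f) (a - b) <= k ^+ 4} ->
  `|soldens ((c, fun x => smooth S f x - f x) :: s) w| <= k.
Proof.
move=> c0 bs s1 k0 S0 hk.
have -> : soldens ((c, fun x => smooth S f x - f x) :: s) w =
   av S (fun a => av S (fun b => soldens ((c, fun x => f (x + (a - b)) - f x) :: s) w)).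
  under [RHS]eq_av do rewrite -soldens_cons_av.
  rewrite -soldens_cons_av; apply: eq_av => x _; congr (_ * _).
  rewrite smoothE -[X in _ - X](av_cst _ S0) -avB; apply: eq_av => a _.
  by rewrite avB av_cst.
apply: norm_av_le => // a aS; apply: norm_av_le => // b bS.
by apply: norm_soldens_osc_le => //; exact: hk.
Qed.

(** Pigeonhole: take the largest colour class. *)
Lemma dense_class (K : finType) (col : F -> K) :
  exists2 S : {set F}, (#|F| <= #|K| * #|S|)%N & {in S &, forall u v, col u = col v}.
Proof.
case: (arg_maxnP (i0 := col 0) (P := predT) (fun k => #|[set u | col u == k]|) isT) => k _ kmax.
exists [set u | col u == k]; last by move=> u v; rewrite !inE => /eqP -> /eqP ->.
rewrite -[X in (X * _)%N]sum1_card big_distrl /= -[#|F|]sum1_card (partition_big col predT) //=.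
apply: leq_sum => j _; rewrite mul1n; apply: leq_trans (kmax j isT).
by rewrite sum1_card; apply: eq_leq; apply: eq_card => u; rewrite !inE.
Qed.

End Smoothing.

(** * Roth's theorem with multiplicity, by energy increment *)

Section Roth.
Variable R : realType.

(** Colour [u] by the tuple of colours of its dilates [c * u]. *)
Lemma osc_colouring_dilates (N n : nat) (eta : R) : 0 < eta -> exists K : finType,
  forall (F : finFieldType) (h : F -> R) (S : {set F}) (cs : seq F),
    (forall x, `|h x| <= 1) -> (#|F| <= N * #|S|)%N -> size cs = n ->
  exists col : F -> K, forall u v, col u = col v ->
    {in cs, forall c, osc (sm S h) (c * (u - v)) <= eta}.
Proof.
move=> eta0; have [M hM] := osc_colouring N eta0.
exists {ffun 'I_n -> 'I_M.+1} => F h S cs h1 FS csn.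
have [col hcol] := hM F h S h1 FS.
exists (fun u => [ffun i : 'I_n => col (nth 0 cs i * u)]) => u v /ffunP e c ccs.
have ic : (index c cs < n)%N by rewrite -csn index_mem.
have := e (Ordinal ic); rewrite !ffunE /= nth_index // => /hcol.
by rewrite mulrBr.
Qed.

Lemma density_bound (al : R) : 0 < al -> exists N : nat,
  forall (F : finFieldType) (A : {set F}), al * #|F|%:R <= #|A|%:R -> (#|F| <= N * #|A|)%N.
Proof.
move=> al0; exists (Num.bound al^-1) => F A hA.
have hb : al^-1 < (Num.bound al^-1)%:R by apply: archi_boundP; rewrite invr_ge0 ltW.
rewrite -(ler_nat R) natrM; apply: (@le_trans _ _ (al^-1 * #|A|%:R)).
  by rewrite ler_pdivlMl.
by apply: ler_wpM2r => //; exact: ltW.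
Qed.

(** Chosen so that the error [(3 * m).+2%:R * k] in [soldens_ge] is half of the main term
    [(al / 2) ^+ m.+2]. *)
Definition kappa (m : nat) (al : R) := (al / 2) ^+ m.+2 / (2 * (3 * m).+2%:R).

Lemma kappa_gt0 m al : 0 < al -> 0 < kappa m al.
Proof. by move=> al0; rewrite divr_gt0 ?exprn_gt0 ?divr_gt0 // mulr_gt0 // ltr0n. Qed.

(* Energy increment: [K] bounds the number of refinements of [S] that are still
   possible before the energy exceeds [1]. *)
Lemma soldens_ge_energy (m K : nat) (al : R) : (0 < m)%N -> 0 < al -> forall N : nat,
  exists2 delta : R, 0 < delta &
  forall (F : finFieldType) (c1 c2 : F) (cs : seq F) (A S : {set F}),
    size cs = m -> 0 \notin c1 :: rcons cs c2 -> c1 + (\sum_(c <- cs) c + c2) = 0 ->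
    al * #|F|%:R <= #|A|%:R -> (#|F| <= N * #|S|)%N ->
    1 - K%:R * (kappa m al ^+ 2 / 2) < energy S (ind R A) ->
    delta <= soldens [seq (c, ind R A) | c <- c1 :: rcons cs c2] 0.
Proof.
move=> m0 al0; have k0 := kappa_gt0 m al0; set k := kappa m al in k0 *.
elim: K => [|K IH] N.
  (* With no refinement left, the hypothesis puts the energy above 1, so any [delta] does. *)
  exists 1 => // F c1 c2 cs A S _ _ _ _ _.
  by rewrite mul0r subr0 ltNge energy_le1 //; exact: ind01.
have k20 : 0 < k ^+ 2 by rewrite exprn_gt0.
have [K1 hK1] := osc_colouring_dilates N m.+1 k20.
(* The successor keeps [tau] positive without knowing that [K1] is inhabited. *)
pose tau : R := (#|K1|.+1)%:R^-1.
have tau0 : 0 < tau by rewrite invr_gt0 ltr0n.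
pose d1 := tau ^+ m * ((al / 2) ^+ m.+2 / 2).
have d10 : 0 < d1 by rewrite mulr_gt0 ?exprn_gt0 ?divr_gt0 ?exprn_gt0 ?divr_gt0.
(* Replacing the [m.+2] weights, at cost [k2] each, loses half of [d1], the bound that [soldens_ge]
   gives for the smoothed weight. *)
pose k2 := d1 / 2 / m.+2%:R.
have k2_0 : 0 < k2 by rewrite !divr_gt0 ?ltr0n.
have [NA hNA] := density_bound al0.
have eta0 : 0 < k2 ^+ 4 / 4 by rewrite divr_gt0 ?exprn_gt0.
have [MA hMA] := osc_colouring NA eta0.
(* With this tolerance the error in [sqn_smoothB_le] is [k ^+ 2 / 2]; an energy gain of at most
   [k ^+ 2 / 2] then yields a squared distance of at most [k ^+ 2]. *)
have k1_0 : 0 < (k ^+ 2 / 4) ^+ 2 by rewrite exprn_gt0 ?divr_gt0.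
have [MG hMG] := osc_colouring N k1_0.
(* The refined set is a largest class for pairs of colours, so the number of pairs is its new
   density parameter. *)
have [d2 d20 hd2] := IH #|{: 'I_MA.+1 * 'I_MG.+1}|.
exists (Num.min (d1 / 2) d2); first by rewrite lt_min d20 divr_gt0.
move=> F c1 c2 cs A S csm cs0 csum hA hS hen.
have Fpos : (0 < #|F|)%N by apply/card_gt0P; exists 0.
pose f := ind R A; have f01 := ind01 R A : forall x, 0 <= f x <= 1.
have f1 x : `|f x| <= 1 by exact: norm_ge0_le1.
have S_0 : S != set0 by apply: contraTneq hS => ->; rewrite cards0 muln0 -ltnNge.
pose h := smN S f; have h1 x : `|h x| <= 1 by apply: norm_ge0_le1; exact: smN01.
pose g := smooth S f; have g01 := smooth01 S f01 : forall x, 0 <= g x <= 1.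
have [colA hcolA] := hMA F f A f1 (hNA _ _ hA).
have [colG hcolG] := hMG F h S h1 hS.
(* Differences in [S'] are almost periods of [corr f], so [f'] has nearly as many solutions as [f],
   and of [g], so [f'] is close to [g] unless energy is gained. *)
have [S' hS' S'col] := dense_class (fun u => (colA u, colG u)).
have S'0 : S' != set0 by apply: contraTneq hS' => ->; rewrite cards0 muln0 -ltnNge.
have S'A : {in S' &, forall a b, 4 * osc (corr f) (a - b) <= k2 ^+ 4}.
  move=> a b aS bS; have [/hcolA hab _] := S'col a b aS bS.
  have := le_trans (osc_corr_ind_le R A (a - b)) hab; rewrite -/f.
  by rewrite ler_pdivlMr // mulrC.
have S'G : {in S' &, forall a b, osc g (a - b) <= (k ^+ 2 / 4) ^+ 2}.
  by move=> a b aS bS; have [_ /hcolG hab] := S'col a b aS bS.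
pose f' := smooth S' f; have f'01 := smooth01 S' f01 : forall x, 0 <= f' x <= 1.
rewrite ge_min; have [inc|noinc] := ltP (energy S f + k ^+ 2 / 2) (energy S' f).
  apply/orP; right; apply: (hd2 F c1 c2 cs A S') => //.
  have := hen; rewrite -/f -[K.+1%:R]natr1; lra.
apply/orP; left.
have close : av [set: F] (fun x => `|f' x - g x|) <= k.
  apply: norm_E_le; first exact: ltW.
  have k4 : 0 <= k ^+ 2 / 4 by rewrite divr_ge0 // ltW.
  have := sqn_smoothB_le f01 S'0 k4 S'G; rewrite -/f' -/g; lra.
have [col hcol] := hK1 F h S (c2 :: cs) h1 hS (congr1 succn csm).
have [S1 hS1 S1col] := dense_class col.
have S10 : S1 != set0 by apply: contraTneq hS1 => ->; rewrite cards0 muln0 -ltnNge.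
have [u0 u0S1] := set0Pn _ S10.
pose Q := [set u - u0 | u in S1].
have Qosc c t : c \in c2 :: cs -> t \in Q -> osc g (c * t) <= k ^+ 2.
  by move=> cc /imsetP[u uS1 ->]; apply: hcol => //; apply: S1col.
have Qtau : tau * #|F|%:R <= #|Q|%:R.
  rewrite card_imset; last exact: addIr.
  rewrite ler_pdivrMl ?ltr0n // -natrM ler_nat.
  by apply: leq_trans hS1 _; rewrite leq_mul2r leqnSn orbT.
have alE : al <= av [set: F] g.
  by rewrite E_smooth // E_ind ler_pdivlMr ?ltr0n.
have := cs0; rewrite inE mem_rcons inE !negb_or => /and3P[c1_0 c2_0 cs_0].
have f'0 x : 0 <= f' x by case/andP: (f'01 x).
have f'1 x : f' x <= 1 by case/andP: (f'01 x).
have g0 x : 0 <= g x by case/andP: (g01 x).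
have g1 x : g x <= 1 by case/andP: (g01 x).
have c2n : c2 != 0 by rewrite eq_sym.
have Q2 t : t \in Q -> av [set: F] (fun x => `|g (x + c2 * t) - g x|) <= k.
  by move=> tQ; apply: E_osc_le; [exact: ltW | apply: Qosc; rewrite ?inE ?eqxx].
have Qcs c t : c \in cs -> t \in Q -> av [set: F] (fun x => `|g (x + - c * t) - g x|) <= k.
  move=> ccs tQ; apply: E_osc_le; first exact: ltW.
  by rewrite mulNr oscN Qosc // inE ccs orbT.
have pos := soldens_ge f'0 f'1 g0 g1 close c2n (ltW tau0) Qtau csum (ltW al0) alE Q2 Qcs.
have {}pos : d1 <= soldens [seq (c, f') | c <- c1 :: rcons cs c2] 0.
  apply: le_trans pos; rewrite csm; apply: eq_ler; congr (_ * _).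
  have : (3 * m).+2%:R != 0 :> R by rewrite pnatr_eq0.
  rewrite /k /kappa; move: (_.+2%:R : R) ((al / 2) ^+ _ : R) => a b a0.
  by field.
have f'n x : `|f' x| <= 1 by exact: norm_ge0_le1.
have sm_le c s w : c != 0 -> bounded s -> (1 < size s)%N ->
    `|soldens ((c, fun x => f' x - f x) :: s) w| <= k2.
  by move=> c0 bs s1; apply: norm_soldens_smooth_le => //; exact: ltW.
have := norm_soldens_replace_le f1 f'n sm_le 0 cs0.
rewrite /= size_rcons csm !ltnS m0 => /(_ isT).
have -> : m.+2%:R * k2 = d1 / 2 by rewrite mulrC /k2 divfK // pnatr_eq0.
move=> /ler_normlP[_ hh]; move: pos hh => /=; lra.
Qed.

(** The increment starts from the whole field, with so many refinements allowed that the energy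
    hypothesis asks for more than a negative number only. *)
Lemma soldens_ge_dense (m : nat) (al : R) : (0 < m)%N -> 0 < al ->
  exists2 delta : R, 0 < delta &
  forall (F : finFieldType) (cs : seq F) (A : {set F}),
    size cs = m.+2 -> 0 \notin cs -> \sum_(c <- cs) c = 0 -> al * #|F|%:R <= #|A|%:R ->
    delta <= soldens [seq (c, ind R A) | c <- cs] 0.
Proof.
move=> m0 al0.
pose th := kappa m al ^+ 2 / 2.
have th0 : 0 < th by rewrite divr_gt0 ?exprn_gt0 ?kappa_gt0.
have hb : th^-1 < (Num.bound th^-1)%:R by apply: archi_boundP; rewrite invr_ge0 ltW.
have [delta d0 hd] := soldens_ge_energy (Num.bound th^-1) m0 al0 1.
exists delta => // F [//|c1 cs] A; case/lastP: cs => // cs c2.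
rewrite big_cons -cats1 big_cat big_seq1 /= cats1 size_rcons => -[csm] cs0 csum hA.
apply: (hd F c1 c2 cs A [set: F]) => //; first by rewrite cardsT mul1n.
apply: lt_le_trans (energy_ge0 _ _).
by rewrite subr_lt0 -ltr_pdivrMr ?div1r.
Qed.

End Roth.

(** * From many solutions to one with distinct entries *)

Section DistinctSolutions.
Variables (R : realType) (F : finFieldType).
Local Notation E := (av [set: F]).

(** Otherwise the sum of [h] is at most [z] over [Z] plus [D / #|F|] for each other point. *)
Lemma exists_notin_gt (h : F -> R) (Z : {set F}) (z : nat) (D : R) :
  (forall x, h x <= 1) -> (#|Z| <= z)%N -> 0 <= D -> z%:R + D < #|F|%:R * E h ->
  exists2 x, x \notin Z & D < #|F|%:R * h x.
Proof.
move=> h1 Zz D0 hD.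
have Fpos : (0 : R) < #|F|%:R by rewrite ltr0n; apply/card_gt0P; exists 0.
apply/exists_inP; apply: contraT; rewrite negb_exists_in => /forall_inP hle.
have : #|F|%:R * E h <= z%:R + D; last by rewrite leNgt hD.
rewrite /av cardsT mulrC divfK ?gt_eqF // (bigID (mem Z)) /=; apply: lerD.
  apply: (@le_trans _ _ (\sum_(x in [set: F] | x \in Z) 1)); first exact: ler_sum.
  rewrite sumr_const ler_nat; apply: leq_trans Zz; apply: eq_leq.
  by apply: eq_card => x; rewrite unfold_in inE.
apply: (@le_trans _ _ (\sum_(x in F) D / #|F|%:R)); last first.
  by rewrite sumr_const -[leLHS]mulr_natr divfK ?gt_eqF.
rewrite [leRHS](bigID (fun x => x \notin Z)) /= -[leLHS]addr0 lerD //.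
  rewrite (eq_bigl (fun x => x \notin Z)); last by move=> x; rewrite inE.
  by apply: ler_sum => x xZ; rewrite ler_pdivlMr // mulrC leNgt hle.
by apply: sumr_ge0 => x _; rewrite divr_ge0 // ltW.
Qed.

(* The number of values to be avoided, over all choices, when [n.+2] distinct
   unknowns outside a set of size [z] are picked one after the other. *)
Fixpoint excl (n z : nat) : nat :=
  if n is n'.+1 then (z.+1 + excl n' z.+1)%N else (2 * z).+1.

(** Unknowns are fixed one at a time, the chosen value joining [Z]. The last two need [w != 0],
    since for [w = 0] and opposite coefficients all solutions have equal entries. *)
Lemma exists_distinct_solution (A : {set F}) (I : eqType) (c : I -> F) (n : nat) :
  forall (s : seq I) (Z : {set F}) (z : nat) (w : F),
  size s = n.+2 -> uniq s -> {in s, forall i, c i != 0} -> (#|Z| <= z)%N ->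
  (n = 0%N -> w != 0) ->
  (excl n z)%:R < #|F|%:R * soldens [seq (c i, ind R A) | i <- s] w ->
  exists x : I -> F, [/\ {in s &, injective x}, {in s, forall i, x i \in A :\: Z}
     & \sum_(i <- s) c i * x i = w].
Proof.
have ind_gt0 x : 0 < ind R A x -> x \in A.
  by rewrite /ind; case: (x \in A) => //; rewrite ltxx.
have Fge0 : (0 : R) <= #|F|%:R by exact: ler0n.
have mul01 (a b : R) : 0 <= a <= 1 -> b <= 1 -> a * b <= 1.
  by case/andP=> a0 a1 b1; nra.
elim: n => [|n IH] s Z z w.
  case: s => [//|i [//|j [|//]]] _ /andP[ij _] c0 Zz w0 hT.
  have {}w0 := w0 erefl; rewrite inE in ij.
  have ci : c i != 0 by apply: c0; rewrite inE eqxx.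
  have cj : c j != 0 by apply: c0; rewrite !inE eqxx orbT.
  pose g y := (w - c i * y) / c j.
  (* Excluded are [y] in [Z], [y] with partner [g y] in [Z], and the only candidate for [y = g y].
     If [c i + c j = 0] there is no such [y], as [w != 0]. *)
  pose Z' := (Z :|: [set (w - c j * x) / c i | x in Z]) :|: [set w / (c i + c j)].
  have Z'z : (#|Z'| <= (2 * z).+1)%N.
    apply: leq_trans (leq_card_setU _ _) _; rewrite cards1 addn1 ltnS.
    apply: leq_trans (leq_card_setU _ _) _; rewrite mul2n -addnn leq_add //.
    exact: leq_trans (leq_imset_card _ _) Zz.
  have [|||y yZ' hy] := @exists_notin_gt (fun y => ind R A y * ind R A (g y)) Z' _ 0 _ Z'z.
  - by move=> y; apply: mul01; [exact: ind01 | case/andP: (ind01 R A (g y))].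
  - by [].
  - move: hT; rewrite addr0 /=.
    suff -> : av [set: F] (fun x => ind R A x * soldens [:: (c j, ind R A)] (w - c i * x))
      = av [set: F] (fun y => ind R A y * ind R A (g y)) by [].
    by apply: eq_av => x _; rewrite soldens1.
  have hy' : 0 < ind R A y * ind R A (g y).
    by rewrite -(@pmulr_rgt0 _ #|F|%:R) // ltr0n; apply/card_gt0P; exists 0.
  have yA : y \in A.
    by move: hy'; rewrite {1}/ind; case: (y \in A) => //; rewrite mul0r ltxx.
  have gA : g y \in A.
    by move: hy'; rewrite {2}/ind; case: (g y \in A) => //; rewrite mulr0 ltxx.
  move: yZ'; rewrite !inE !negb_or => /andP[/andP[yZ yim] yw].
  have gy : c i * y + c j * g y = w by rewrite /g; field.
  have gZ : g y \notin Z.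
    apply: contra yim => gZ; apply/imsetP; exists (g y) => //.
    by rewrite -[X in X - _]gy addrK mulrC mulKf.
  have yg : y != g y.
    apply: contra yw => /eqP yg; rewrite -yg -mulrDl in gy.
    have cs0 : c i + c j != 0 by apply: contraNneq w0 => h; rewrite -gy h mul0r.
    by apply/eqP; rewrite -gy mulrAC divff ?mul1r.
  exists (fun l => if l == i then y else g y); split.
  - move=> a b; rewrite !inE => /orP[/eqP->|/eqP->] /orP[/eqP->|/eqP->] //;
      rewrite ?eqxx ![j == i]eq_sym (negbTE ij) => /eqP; first by rewrite (negbTE yg).
    by rewrite eq_sym (negbTE yg).
  - move=> a; rewrite !inE => /orP[/eqP->|/eqP->]; rewrite ?eqxx ?yZ ?yA //.
    by rewrite eq_sym (negbTE ij) gZ gA.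
  - by rewrite big_cons big_seq1 eqxx eq_sym (negbTE ij).
case: s => [//|i s] /= [ss] /andP[is_ us] c0 Zz _ hT.
have ci : c i != 0 by apply: c0; rewrite inE eqxx.
have c0s : {in s, forall j, c j != 0} by move=> j js; apply: c0; rewrite inE js orbT.
(* Avoiding [w / c i] keeps the remaining right-hand side nonzero. *)
pose Z' := (w / c i) |: Z.
have Z'z : (#|Z'| <= z.+1)%N by rewrite cardsU1; apply: leq_add (leq_b1 _) Zz.
have bs : bounded [seq (c j, ind R A) | j <- s].
  rewrite (map_comp (fun d => (d, ind R A)) c); apply: bounded_map.
    by move=> x; apply: norm_ge0_le1; exact: ind01.
  by apply/mapP => -[j js] /esym /eqP; rewrite (negbTE (c0s j js)).
have Tle x : soldens [seq (c j, ind R A) | j <- s] x <= 1.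
  by apply: le_trans (ler_norm _) _; apply: norm_soldens_le => //; rewrite size_map ss.
have [|||x xZ' hx] := @exists_notin_gt
   (fun x => ind R A x * soldens [seq (c j, ind R A) | j <- s] (w - c i * x)) Z' _ (excl n z.+1)%:R _ Z'z.
- by move=> x; apply: mul01 => //; exact: ind01.
- exact: ler0n.
- by rewrite -natrD.
have xA : x \in A.
  move: hx; rewrite /ind; case: (x \in A) => //.
  by rewrite mul0r mulr0 ltNge ler0n.
move: xZ'; rewrite !inE negb_or => /andP[xw xZ].
have [|||y [yinj yA ysum]] := IH s (x |: Z) z.+1 (w - c i * x) ss us c0s _ _ _.
- by rewrite cardsU1; apply: leq_add (leq_b1 _) Zz.
- by move=> _; rewrite subr_eq0; apply: contra xw => /eqP ->; rewrite mulrAC divff ?mul1r.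
- by move: hx; rewrite {1}/ind xA mul1r.
have yx j : j \in s -> y j != x by move=> /yA; rewrite !inE negb_or => /andP[/andP[]].
have ji j : j \in s -> (j == i) = false by apply: contraTF => /eqP ->.
exists (fun j => if j == i then x else y j); split.
- move=> a b; rewrite !inE.
  have [->|ai] := eqVneq a i; have [->|bi] := eqVneq b i => //=.
  + by move=> _ /yx /eqP h /esym /h.
  + by move=> /yx /eqP h _ /h.
  + exact: yinj.
- move=> j; rewrite inE; have [->|_] := eqVneq j i; first by rewrite !inE xZ xA.
  by move=> /= /yA; rewrite !inE negb_or => /andP[/andP[_ ->] ->].
- rewrite big_cons eqxx; under eq_big_seq => j js do rewrite ji //.
  by rewrite ysum addrC subrK.
Qed.

End DistinctSolutions.

(** * Graph colourings and the final assembly *)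

Lemma greedy_colouring (X : finType) (adj : rel X) (d : nat) :
  symmetric adj -> irreflexive adj -> (forall x, (#|[set y | adj x y]| <= d)%N) ->
  exists f : X -> 'I_d.+1, forall u v, adj u v -> f u != f v.
Proof.
move=> adjC adjI hd.
suff H : forall s : seq X, exists f : X -> 'I_d.+1, {in s &, forall u v, adj u v -> f u != f v}.
  by have [f hf] := H (enum X); exists f => u v; apply: hf; rewrite mem_enum.
elim=> [|x s [f hf]]; first by exists (fun=> ord0).
have [a aN] : exists a, a \notin f @: [set y | adj x y].
  apply/existsP; rewrite -negb_forall; apply/negP => /forallP fT.
  have : (#|'I_d.+1| <= #|f @: [set y | adj x y]|)%N.
    by apply: subset_leq_card; apply/subsetP => a _; apply: fT.
  by rewrite card_ord => /leq_trans /(_ (leq_imset_card _ _)) /leq_trans /(_ (hd x)); rewrite ltnn.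
have aP y : adj x y -> a != f y.
  by move=> xy; apply: contraNneq aN => ->; apply: imset_f; rewrite inE.
exists (fun y => if y == x then a else f y) => u v; rewrite !inE.
have [->|ux] := eqVneq u x; have [->|vx] := eqVneq v x => //=.
- by rewrite adjI.
- by move=> _ _; exact: aP.
- by move=> _ _; rewrite adjC eq_sym; exact: aP.
- exact: hf.
Qed.

Lemma cay_colorable_finType (p : nat) (A : {set 'F_p}) (L : finType) (C : nat)
    (f : 'F_p -> L) : (#|L| <= C)%N ->
  (forall u v, cay_adj A u v -> f u != f v) -> cay_colorable A C.
Proof.
move=> LC hf; exists (fun u => widen_ord LC (enum_rank (f u))) => u v /hf.
by apply: contra => /eqP /(congr1 val) /= /val_inj /enum_rank_inj ->.
Qed.

Lemma cay_degree (p : nat) (A : {set 'F_p}) (u : 'F_p) :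
  (#|[set v | cay_adj A u v]| <= 2 * #|A|)%N.
Proof.
apply: (@leq_trans #|[set u + a | a in A] :|: [set u - a | a in A]|).
  apply: subset_leq_card; apply/subsetP => v; rewrite !inE => /andP[_ /orP[h|h]].
    by apply/orP; left; apply/imsetP; exists (v - u); rewrite // addrC subrK.
  by apply/orP; right; apply/imsetP; exists (u - v); rewrite // opprB addrC subrK.
apply: leq_trans (leq_card_setU _ _) _; rewrite mul2n -addnn.
by apply: leq_add; exact: leq_imset_card.
Qed.

Lemma intr_Fp_neq0 (p : nat) (c : int) : prime p -> c != 0 -> (`|c| < p)%N ->
  c%:~R != 0 :> 'F_p.
Proof.
move=> pp c0 cp.
have cn : (`|c|)%N%:R != 0 :> 'F_p.
  rewrite -(dvdn_pcharf (pchar_Fp pp)) gtnNdvd // absz_gt0 //.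
by case: (intP c) c0 cp cn => // n _ _; rewrite ?abszN ?mulrNz ?oppr_eq0.
Qed.

(* Moving the right-hand side by [c1 * t] amounts to translating the first weight by [t]. *)
Lemma norm_soldens_sum_shift (R : realType) (F : finFieldType) (J : eqType) (f : F -> R)
    (c1 : F) s (k : R) (y : J -> F) (r : seq J) :
  c1 != 0 -> bounded s -> (1 < size s)%N -> 0 <= k ->
  {in r, forall j, 4 * osc (corr f) (y j / c1) <= k ^+ 4} ->
  soldens ((c1, f) :: s) 0 - (size r)%:R * k <= soldens ((c1, f) :: s) (- \sum_(j <- r) y j).
Proof.
move=> c10 bs s1 k0; elim: r => [|j r IH] hr; first by rewrite big_nil oppr0 mul0r subr0.
have /IH {}IH : {in r, forall j, 4 * osc (corr f) (y j / c1) <= k ^+ 4}.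
  by move=> i ir; apply: hr; rewrite inE ir orbT.
rewrite big_cons.
have -> : - (y j + \sum_(i <- r) y i) = - \sum_(i <- r) y i + c1 * (- (y j / c1)).
  by rewrite mulrN mulrC divfK // opprD addrC.
rewrite soldens_shift /= -[(size r).+1%:R]natr1.
have := @norm_soldens_osc_le _ _ c1 f s (- \sum_(j <- r) y j) (- (y j / c1)) k c10 bs s1 k0.
rewrite oscN hr ?inE ?eqxx // => /(_ isT).
rewrite soldens_consB => /ler_normlP[hh _]; move: IH hh => /=; lra.
Qed.

Theorem theorem3p1 (k : nat) (c : 'I_k -> int)
  (hk : (3 <= k)%N) (hc : forall i, c i != 0)
  (hI : exists I : {set 'I_k}, (3 <= #|I|)%N /\ \sum_(i in I) c i = 0)
  (R : realType) (eps : R) (heps : 0 < eps) :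
  exists C : nat, forall (p : nat), prime p ->
    forall A : {set 'F_p}, solution_free c A ->
      eps * p%:R <= #|A|%:R -> cay_colorable A C.
Proof.
case: hI => I [I3 cI0].
have [m [m0 Im]] : exists m, (0 < m)%N /\ #|I| = m.+2.
  by exists (#|I| - 2)%N; split; lia.
have [delta d0 hdelta] := soldens_ge_dense m0 heps.
have k0 : (0 : R) < k%:R by rewrite ltr0n; lia.
(* At most [k] unknowns are moved to the right-hand side, at cost [kap] each, so half of [delta]
   remains. *)
pose kap := delta / 2 / k%:R.
have kap0 : 0 < kap by rewrite !divr_gt0.
have eta0 : 0 < kap ^+ 4 / 4 by rewrite divr_gt0 ?exprn_gt0.
have [NA hNA] := density_bound heps.
have [K hK] := osc_colouring_dilates NA k eta0.
(* Beyond [P0] no [c i] vanishes modulo [p], and [p * (delta / 2)] exceeds the number of values to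
   avoid. Up to [P0] all points get different colours. *)
pose P0 := maxn (Num.bound (2 * (excl m k)%:R / delta)) (\max_(i < k) `|c i|%N).
exists (#|{: K * 'I_(2 * k).+1}| + P0)%N => p pp A Afree hA.
have cardF : #|'F_p| = p by exact: card_Fp.
have [pP0|pP0] := leqP p P0.
  apply: (cay_colorable_finType (f := id)); last by move=> u v /andP[].
  by rewrite cardF; apply: leq_trans pP0 (leq_addl _ _).
have cF i : (c i)%:~R != 0 :> 'F_p.
  apply: intr_Fp_neq0 => //; apply: leq_ltn_trans pP0.
  by rewrite leq_max; apply/orP; right; exact: leq_bigmax.
have hAF : eps * #|'F_p|%:R <= #|A|%:R by rewrite cardF.
pose f := ind R A.
have f1 x : `|f x| <= 1 by apply: norm_ge0_le1; exact: ind01.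
case eI: (enum I) => [|i1 s]; first by move: Im; rewrite cardE eI.
(* Moving the right-hand side by [c j * t] translates the weight of [i1] by [c j / c i1 * t], up to
   sign; hence these dilates. *)
pose dil := [seq (c j)%:~R / (c i1)%:~R : 'F_p | j <- enum 'I_k].
have dilk : size dil = k by rewrite size_map size_enum_ord.
have [col hcol] := hK _ f A dil f1 (hNA _ _ hAF) dilk.
pose per t := [forall j, osc (sm A f) ((c j)%:~R / (c i1)%:~R * t) <= kap ^+ 4 / 4].
have col_per u v : col u = col v -> per (u - v).
  move=> /hcol h; apply/forallP => j; apply: h.
  by apply: map_f; rewrite mem_enum.
pose B := [set t in A | per t].
(* An edge inside a class of [col] has its difference, in one direction, in [B]; if [B] is small, a
   greedy colouring separates the ends of these edges. *)
have [kB|Bk] := leqP k #|B|; last first.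
  have [g hg] : exists g : 'F_p -> 'I_(2 * k).+1, forall u v, cay_adj B u v -> g u != g v.
    apply: greedy_colouring.
    - by move=> u v; rewrite /cay_adj eq_sym orbC.
    - by move=> u; rewrite /cay_adj eqxx.
    - by move=> u; apply: leq_trans (cay_degree _ _) _; rewrite leq_mul2l ltnW.
  apply: (cay_colorable_finType (f := fun u => (col u, g u))); first exact: leq_addr.
  move=> u v /andP[uv uvA]; rewrite xpair_eqE; apply/nandP.
  have [cuv|] := eqVneq (col u) (col v); last by left.
  right; apply: hg; rewrite /cay_adj uv !inE.
  by rewrite (col_per _ _ cuv) (col_per _ _ (esym cuv)) !andbT.
exfalso; apply: Afree.
(* Distinct values for the unknowns outside [I]; the default 0 is never reached because
   [k <= #|B|]. *)
pose y0 (j : 'I_k) : 'F_p := nth 0 (enum B) j.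
have y0lt (j : 'I_k) : (j < size (enum B))%N by rewrite -cardE; apply: leq_trans kB.
have y0B j : y0 j \in B by rewrite -mem_enum; apply: mem_nth.
have y0inj : injective y0.
  by move=> i j /eqP; rewrite nth_uniq ?enum_uniq // => /eqP /val_inj.
pose rJ := enum (~: I).
pose Z := [set y0 j | j in ~: I].
have Zk : (#|Z| <= k)%N.
  by apply: leq_trans (leq_imset_card _ _) _; rewrite -[X in (_ <= X)%N]card_ord max_card.
pose w := - \sum_(j <- rJ) (c j)%:~R * y0 j.
have c_s : [seq (d, f) | d <- [seq (c i)%:~R : 'F_p | i <- enum I]]
   = ((c i1)%:~R, f) :: [seq ((c i)%:~R, f) | i <- s] by rewrite -map_comp eI.
have n0 (r : seq 'I_k) : 0 \notin [seq (c i)%:~R : 'F_p | i <- r].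
  by apply/mapP => -[i _] /esym /eqP; rewrite (negbTE (cF i)).
have Tpos : delta <= soldens (((c i1)%:~R, f) :: [seq ((c i)%:~R, f) | i <- s]) 0.
  rewrite -c_s; apply: hdelta => //.
  - by rewrite size_map -cardE.
  - by rewrite big_map big_enum /= -rmorph_sum /= cI0.
have size_s : size s = m.+1 by move: Im; rewrite cardE eI => -[].
have Tw : delta / 2 <= soldens [seq ((c i)%:~R, f) | i <- enum I] w.
  rewrite eI /=.
  have bs : bounded [seq ((c i)%:~R : 'F_p, f) | i <- s].
    by rewrite (map_comp (fun d => (d, f))); apply: bounded_map.
  have s1 : (1 < size [seq ((c i)%:~R : 'F_p, f) | i <- s])%N by rewrite size_map size_s ltnS.
  have hr : {in rJ, forall j, 4 * osc (corr f) ((c j)%:~R * y0 j / (c i1)%:~R) <= kap ^+ 4}.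
    move=> j _; have := y0B j; rewrite inE => /andP[_ /forallP /(_ j)].
    move/(le_trans (osc_corr_ind_le _ _ _)); rewrite ler_pdivlMr // mulrC.
    by rewrite mulrAC.
  have := norm_soldens_sum_shift (cF i1) bs s1 (ltW kap0) hr; apply: le_trans.
  have : (size rJ)%:R * kap <= delta / 2.
    apply: (@le_trans _ _ (k%:R * kap)).
      apply: ler_wpM2r; first exact: ltW.
      by rewrite ler_nat -cardE -[X in (_ <= X)%N]card_ord max_card.
    by rewrite /kap mulrC divfK ?gt_eqF.
  by move: Tpos => /=; lra.
have big_p : (excl m k)%:R < #|'F_p|%:R * soldens [seq ((c i)%:~R, f) | i <- enum I] w.
  apply: (@lt_le_trans _ _ (p%:R * (delta / 2))); last first.
    by rewrite cardF ler_wpM2l.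
  rewrite -ltr_pdivrMr ?divr_gt0 //.
  have -> : (excl m k)%:R / (delta / 2) = 2 * (excl m k)%:R / delta.
    by field; rewrite gt_eqF.
  apply: (@lt_trans _ _ (Num.bound (2 * (excl m k)%:R / delta))%:R).
    by apply: archi_boundP; rewrite divr_ge0 ?mulr_ge0 // ltW.
  by rewrite ltr_nat; apply: leq_ltn_trans pP0; exact: leq_maxl.
have [||||x [xinj xA xsum]] := exists_distinct_solution _ _ _ Zk _ big_p.
- by rewrite -cardE.
- exact: enum_uniq.
- by [].
- by move=> mE; rewrite mE in m0.
exists (fun i => if i \in I then x i else y0 i); split.
- have xZ i j : i \in I -> j \notin I -> x i != y0 j.
    move=> iI jI; have := xA i; rewrite mem_enum iI !inE => /(_ isT) /andP[xiZ _].
    by apply: contraNneq xiZ => ->; apply: imset_f; rewrite inE.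
  move=> i j; case: ifPn => iI; case: ifPn => jI //.
  + by apply: xinj; rewrite mem_enum.
  + by move=> e; have := xZ _ _ iI jI; rewrite e eqxx.
  + by move=> e; have := xZ _ _ jI iI; rewrite e eqxx.
  + exact: y0inj.
- move=> i; case: ifPn => iI; last by have := y0B i; rewrite inE => /andP[].
  by have := xA i; rewrite mem_enum iI !inE => /(_ isT) /andP[].
- rewrite (bigID (mem I)) /=.
  have -> : \sum_(i in I) (c i)%:~R * (if i \in I then x i else y0 i) = w.
    rewrite -xsum big_enum /=; apply: eq_bigr => i ->; by [].
  rewrite /w /rJ big_enum /= addrC; apply/eqP; rewrite subr_eq0; apply/eqP.
  apply: eq_big => [i|i /negbTE ->] //; by rewrite inE.
Qed.
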